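(* Let $G$ and $H$ be two graphs of the same order $n$. Then $\mathrm{Main}(G)=\mathrm{Main}(H)$ if and only if there is an invertible (square) matrix $\mathbf Q$ such that $\mathbf W_G\mathbf Q=\mathbf W_H$.
   Context: All graphs are finite, simple and undirected, with vertex set $\{1,\dots,n\}$; the adjacency matrix $\mathbf A=\mathbf A(G)$ is the symmetric $n\times n$ $(0,1)$-matrix with $(i,j)$ entry $1$ iff $\{i,j\}$ is an edge. Eigenvalues and eigenvectors of $G$ are those of $\mathbf A$. Let $\mathbf j=(1,\dots,1)^T\in\mathbb R^n$. An eigenvalue of $G$ is main if it has an associated eigenvector not orthogonal to $\mathbf j$. Let $\mu_1,\dots,\mu_p$ be the distinct main eigenvalues of $G$ and $\mathbf P_i$ the orthogonal projection of $\mathbb R^n$ onto the eigenspace $\{\mathbf x\in\mathbb R^n:\mathbf A\mathbf x=\mu_i\mathbf x\}$. The main eigenspace of $G$ is $\mathrm{Main}(G)=\mathrm{span}\{\mathbf P_1\mathbf j,\dots,\mathbf P_p\mathbf j\}\subseteq\mathbb R^n$. The walk matrix $\mathbf W_G$ is the $n\times p$ matrix whose columns are $\mathbf j,\mathbf A\mathbf j,\dots,\mathbf A^{p-1}\mathbf j$, where $p$ is the number of distinct main eigenvalues of $G$ (so the number of columns depends on the graph). Matrices have real entries. The vertices of the graphs carry fixed labels $1,\dots,n$. *)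

(* Defs.v *)
From HB Require Import structures.
From mathcomp Require Import all_boot all_order all_algebra.
From mathcomp Require Import polyrcf.
From mathcomp Require Import boolp reals.

Set Implicit Arguments.
Unset Strict Implicit.
Unset Printing Implicit Defensive.

Import Order.TTheory GRing.Theory Num.Theory.
Local Open Scope ring_scope.

(* The vertex set {1, ..., n} is represented by 'I_n = {0, ..., n-1}. *)
Record sgraph (n : nat) := SGraph {
  adj :> rel 'I_n;
  adj_sym : symmetric adj;
  adj_irr : irreflexive adj
}.

Definition adjmx (R : realType) (n : nat) (G : sgraph n) : 'M[R]_n :=
  \matrix_(i, j) (adj G i j)%:R.

Section DotProduct.
Variables (R : realType) (n : nat).

Definition dotv (u v : 'cV[R]_n) : R := \sum_i u i 0 * v i 0.

Lemma dotv_bilinear :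
  bilinear_for (GRing.Scale.Law.clone _ _ ( *%R ) _)
               (GRing.Scale.Law.clone _ _ (idfun \; *%R ) _) dotv.
Proof.
split=> [u'|u] a x y /=; rewrite /dotv mulr_sumr -big_split /=;
  apply: eq_bigr => i _; rewrite !mxE.
  by rewrite mulrDl mulrA.
by rewrite mulrDr mulrCA.
Qed.

HB.instance Definition _ :=
  bilinear_isBilinear.Build R _ _ _
    (GRing.Scale.Law.clone _ _ ( *%R ) _)
    (GRing.Scale.Law.clone _ _ (idfun \; *%R ) _) dotv dotv_bilinear.

Lemma dotv_sym (u v : 'cV[R]_n) : dotv u v = (-1) ^+ false * idfun (dotv v u).
Proof. by rewrite mul1r; apply: eq_bigr => i _; rewrite mulrC. Qed.

HB.instance Definition _ :=
  isHermitianSesquilinear.Build R _ false idfun dotv dotv_sym.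

Lemma dotv_gt0 (u : 'cV[R]_n) : u != 0 -> 0 < dotv u u.
Proof.
move=> u0; rewrite lt_def sumr_ge0 ?andbT => [|i _]; last exact: sqr_ge0.
apply: contra u0 => /eqP/psumr_eq0P uu0; apply/eqP/colP => i; rewrite mxE.
by have /eqP := uu0 (fun j _ => sqr_ge0 _) i isT; rewrite mulf_eq0 orbb => /eqP.
Qed.

HB.instance Definition _ := isDotProduct.Build R _ dotv dotv_gt0.

(* Orthogonal projection onto U: the projection along the complement of U
   orthogonal for the dot product. *)
Definition orthoproj (U : {vspace 'cV[R]_n}) : 'End('cV[R]_n) :=
  daddv_pi U (orthov dotv U).

Lemma orthov_disjoint (U : {vspace 'cV[R]_n}) : (U :&: orthov dotv U = 0)%VS.
Proof.
apply/eqP; rewrite -subv0; apply/subvP => x /memv_capP[xU /mem_orthovP xo].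
by rewrite memv0; apply: contraT => /dotv_gt0; rewrite xo ?ltxx.
Qed.

Lemma dim_orthov_bigcap (s : seq 'cV[R]_n) :
  (n <= \dim (\bigcap_(u <- s) orthov dotv <[u]>) + size s)%N.
Proof.
elim: s => [|u s IHs]; first by rewrite big_nil dimvf /dim /= muln1 addn0.
rewrite big_cons capvC /= addnS -addSn (leq_trans IHs) // leq_add2r.
by rewrite (leq_trans (leqSpred _)) // ltnS leq_dim_orthov1.
Qed.

Lemma addv_orthov (U : {vspace 'cV[R]_n}) : (U + orthov dotv U = fullv)%VS.
Proof.
apply/eqP; rewrite eqEdim subvf /= dimv_disjoint_sum ?orthov_disjoint //.
rewrite dimvf /dim /= muln1 addnC.
have := dim_orthov_bigcap (vbasis U); rewrite size_tuple => /leq_trans; apply.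
rewrite leq_add2r; apply/dimvS/subvP => x xU; rewrite mem_orthov_sym.
rewrite -[X in (X <= _)%VS](span_basis (vbasisP U)); apply/span_subvP => u uU.
by rewrite mem_orthov1_sym; move: xU; rewrite (big_rem u) //= => /memv_capP[].
Qed.

Lemma orthoprojP (U : {vspace 'cV[R]_n}) (x : 'cV[R]_n) :
  orthoproj U x \in U /\ {in U, forall y, dotv (x - orthoproj U x) y = 0}.
Proof.
split=> [|y yU]; first exact: memv_pi.
have xE : orthoproj U x + daddv_pi (orthov dotv U) U x = x.
  by apply: daddv_pi_add; rewrite ?orthov_disjoint ?addv_orthov ?memvf.
rewrite -{1}xE addrAC subrr add0r.
by move/mem_orthovP: (memv_pi (orthov dotv U) U x); apply.
Qed.

End DotProduct.

Section MainEigenspace.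
Variables (R : realType) (n : nat).
Implicit Types (A : 'M[R]_n) (mu : R) (x : 'cV[R]_n).

Definition jvec : 'cV[R]_n := const_mx 1.

Definition eigspace A mu : {vspace 'cV[R]_n} :=
  passmx.leigenspace (linfun (mulmx A)) mu.

Lemma mem_eigspace A mu x : (x \in eigspace A mu) = (A *m x == mu *: x).
Proof.
rewrite memv_ker add_lfunE opp_lfunE scale_lfunE id_lfunE lfunE /=.
by rewrite subr_eq0.
Qed.

Definition main_eigenvalue A mu : Prop :=
  exists x : 'cV[R]_n, [/\ x != 0, x \in eigspace A mu & dotv x jvec != 0].

(* rootsR (char_poly A) lists the distinct real eigenvalues of A. *)
Definition main_eigenvalues A : seq R :=
  [seq mu <- rootsR (char_poly A) | `[< main_eigenvalue A mu >]].

Lemma main_eigenvalues_uniq A : uniq (main_eigenvalues A).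
Proof. exact/filter_uniq/uniq_roots. Qed.

Lemma mem_main_eigenvalues A mu :
  mu \in main_eigenvalues A <-> main_eigenvalue A mu.
Proof.
rewrite mem_filter; split=> [/andP[/asboolP] //|mA].
apply/andP; split; first exact/asboolP.
have p0 : char_poly A != 0 by exact/monic_neq0/char_poly_monic.
have trA : char_poly A^T = char_poly A.
  rewrite /char_poly -det_tr; congr (\det _); apply/matrixP => i j.
  by rewrite !mxE eq_sym.
rewrite -roots_on_rootsR //= -trA -eigenvalue_root_char.
case: mA => x [x0 + _]; rewrite mem_eigspace => /eqP Ax.
apply/eigenvalueP; exists x^T; first by rewrite -trmx_mul Ax linearZ.
by rewrite -(inj_eq (@trmx_inj _ _ _)) trmxK trmx0.
Qed.

Definition num_main A : nat := size (main_eigenvalues A).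

Definition Main A : {vspace 'cV[R]_n} :=
  <<[seq orthoproj (eigspace A mu) jvec | mu <- main_eigenvalues A]>>%VS.

Definition walkmx A : 'M[R]_(n, num_main A) :=
  \matrix_(i < n, k < num_main A) (A ^+ k *m jvec) i 0.

End MainEigenspace.

(* Main.v *)
(** The orthogonal projections P_mu j onto the main eigenspaces are nonzero and
    pairwise orthogonal.  By the spectral theorem j is their sum, hence
    A^k j = \sum_mu mu^k P_mu j, that is, W = B V where the columns of B are the
    vectors P_mu j and V is the (invertible) transpose of the Vandermonde matrix
    of the main eigenvalues.  So W has rank p and Main(G) is its column space;
    two matrices of full column rank have the same column space iff they differ
    by an invertible right factor. *)
Require Import Defs.
From mathcomp Require Import all_boot all_order all_algebra.
From mathcomp Require Import complex.
From mathcomp Require Import reals.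

Set Implicit Arguments.
Unset Strict Implicit.
Unset Printing Implicit Defensive.

Import Order.TTheory GRing.Theory Num.Theory.
Local Open Scope ring_scope.

(* The complex spectral theorem has real eigenvalues here, and being of full
   rank descends from the complexified eigenspaces to the real ones. *)
Lemma row_full_sum_eigenspace (R : realType) (n : nat) (A : 'M[R]_n) :
  A^T = A -> exists d : 'I_n -> R, row_full (\sum_i eigenspace A (d i))%MS.
Proof.
move=> symA; pose toC := real_complex R.
have hermA : map_mx toC A \is hermsymmx.
  apply: realsym_hermsym; last first.
    by apply/mxOverP => i j; rewrite mxE complex_real.
  by apply/is_hermitianmxP; rewrite expr0 scale1r map_mx_id // map_trmx symA.
have /orthomx_spectralP := hermitian_normalmx hermA.
have /mxOverP := hermitian_spectral_diag_real hermA.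
move: (spectral_diag _) (spectralmx _) (spectral_unit (map_mx toC A)).
move=> d P Punit dreal AE.
exists (fun i => complex.Re (d 0 i)).
rewrite -(row_full_map toC) -sub1mx.
apply: (@submx_trans _ _ _ _ _ _ P); first by rewrite sub1mx row_full_unit.
(* Since [A] is [P^-1 diag(d) P] over the complex numbers, row [i] of [P] is a left eigenvector for
   [d 0 i]. *)
apply/row_subP => i; apply: (@submx_trans _ _ _ _ _ _
  (map_mx toC (eigenspace A (complex.Re (d 0 i))))); last first.
  by rewrite map_submx (sumsmx_sup i).
rewrite map_eigenspace /= RRe_real //; apply/eigenspaceP.
by rewrite AE rowE !mulmxA mulmxK // -!rowE row_diag_mx rowE scalemxAl.
Qed.

(** * Orthogonality of eigenvectors *)

Lemma dotvE (R : realType) (n : nat) (u v : 'cV[R]_n) :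
  dotv u v = (u^T *m v) 0 0.
Proof. by rewrite mxE; apply: eq_bigr => i _; rewrite mxE. Qed.

Lemma dotvC (R : realType) (n : nat) (u v : 'cV[R]_n) : dotv u v = dotv v u.
Proof. by apply: eq_bigr => i _; rewrite mulrC. Qed.

Lemma dotv_mulmx (R : realType) (n : nat) (A : 'M[R]_n) (u v : 'cV[R]_n) :
  A^T = A -> dotv (A *m u) v = dotv u (A *m v).
Proof. by move=> symA; rewrite !dotvE trmx_mul symA mulmxA. Qed.

Lemma dotv_eigspace_neq (R : realType) (n : nat) (A : 'M[R]_n) (a b : R)
    (x y : 'cV[R]_n) :
  A^T = A -> x \in eigspace A a -> y \in eigspace A b -> a != b ->
  dotv x y = 0.
Proof.
move=> symA; rewrite !mem_eigspace => /eqP Ax /eqP Ay neq_ab.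
have /eqP := dotv_mulmx x y symA.
rewrite Ax Ay linearZl_LR linearZr_LR /= -subr_eq0 -mulrBl mulf_eq0.
by rewrite subr_eq0 (negPf neq_ab) /= => /eqP.
Qed.

(** Writing [x] as a sum of eigenvectors gives [dotv x x = 0]. Vector identities can thus be tested
    against eigenvectors only. *)
Lemma dotv_eigspace_eq0 (R : realType) (n : nat) (A : 'M[R]_n) (x : 'cV[R]_n) :
  A^T = A -> (forall mu y, y \in eigspace A mu -> dotv x y = 0) -> x = 0.
Proof.
move=> symA x_orth; have [d fullE] := row_full_sum_eigenspace symA.
have /sub_sumsmxP[u xE] := submx_full x^T fullE.
apply/eqP/contraT => /dotv_gt0; rewrite -{2}[x]trmxK xE linear_sum linear_sumr /=.
rewrite big1 ?ltxx // => i _; apply: (x_orth (d i)).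
(* [eigenspace] consists of rows and [eigspace] of columns; symmetry of [A] lets transposition pass
   between them. *)
rewrite mem_eigspace -[A in A *m _]symA -trmx_mul -mulmxA -linearZ /=.
by rewrite (eigenspaceP (submx_refl _)) -scalemxAr.
Qed.

(** * Factorization and rank of the walk matrix *)

Section MainSpace.
Variables (R : realType) (n : nat) (A : 'M[R]_n).
Hypothesis symA : A^T = A.

Let projj mu : 'cV[R]_n := orthoproj (eigspace A mu) (jvec R n).

Lemma orthoproj_jvec_eigspace mu : projj mu \in eigspace A mu.
Proof. by have [] := orthoprojP (eigspace A mu) (jvec R n). Qed.

Lemma dotv_orthoproj_jvec mu x : x \in eigspace A mu ->
  dotv (projj mu) x = dotv (jvec R n) x.
Proof.
have [_ orth] := orthoprojP (eigspace A mu) (jvec R n).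
by move=> /orth/eqP; rewrite linearBl subr_eq0 => /eqP.
Qed.

(** An eigenvector not orthogonal to j has the same nonzero product with the projection of j. *)
Lemma orthoproj_jvec_neq0 mu : main_eigenvalue A mu -> projj mu != 0.
Proof.
case=> x [_ xmu]; rewrite dotvC -(dotv_orthoproj_jvec xmu).
by apply: contra_neq => ->; rewrite linear0l.
Qed.

Lemma dotv_jvec_not_main mu x :
  ~ main_eigenvalue A mu -> x \in eigspace A mu -> dotv (jvec R n) x = 0.
Proof.
move=> not_main xmu; apply/eqP/contraT => jx; case: not_main; exists x.
by split; rewrite ?(dotvC x) //; apply: contra_neq jx => ->; rewrite linear0r.
Qed.

(** Tested against an eigenvector [y] for [mu], every summand with another eigenvalue vanishes. If
    [mu] is main, its summand has the same product with [y] as j; otherwise j itself is orthogonal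
    to [y]. *)
Lemma jvec_sum_orthoproj :
  jvec R n = \sum_(mu <- main_eigenvalues A) projj mu.
Proof.
apply/eqP; rewrite -subr_eq0; apply/eqP/(dotv_eigspace_eq0 symA) => mu y ymu.
have orth nu : nu != mu -> dotv (projj nu) y = 0.
  exact/dotv_eigspace_neq/ymu/orthoproj_jvec_eigspace.
rewrite linearBl linear_sumlz /=.
have [mu_main|mu_not_main] := boolP (mu \in main_eigenvalues A).
  rewrite (bigD1_seq mu mu_main (main_eigenvalues_uniq A)).
  by rewrite big1 // [X in _ - X]addr0 -(dotv_orthoproj_jvec ymu) subrr.
rewrite big1_seq ?subr0 => [|nu /= nu_main].
  by apply: dotv_jvec_not_main ymu => /mem_main_eigenvalues; apply/negP.
by apply: orth; apply: contraNneq mu_not_main => <-.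
Qed.

Let mainv (i : 'I_(num_main A)) : R := (main_eigenvalues A)`_i.

Definition mainmx : 'M[R]_(n, num_main A) :=
  \matrix_(i, k) projj (mainv k) i 0.

Lemma mulmx_exp_eigspace mu (x : 'cV[R]_n) k :
  x \in eigspace A mu -> A ^+ k *m x = mu ^+ k *: x.
Proof.
rewrite mem_eigspace => /eqP Ax.
elim: k => [|k IHk]; first by rewrite !expr0 mul1mx scale1r.
by rewrite exprSr -mulmxA Ax -scalemxAr IHk scalerA exprS.
Qed.

Lemma walkmx_mainmx :
  walkmx A = mainmx *m (Vandermonde (num_main A) (\row_i mainv i))^T.
Proof.
apply/matrixP => i k; rewrite mxE [RHS]mxE.
rewrite [in LHS]jvec_sum_orthoproj mulmx_sumr summxE (big_nth 0) big_mkord.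
apply: eq_bigr => l _.
by rewrite (mulmx_exp_eigspace _ (orthoproj_jvec_eigspace _)) !mxE mulrC.
Qed.

Lemma Vandermonde_main_unit :
  (Vandermonde (num_main A) (\row_i mainv i))^T \in unitmx.
Proof.
rewrite unitmx_tr unitmxE det_Vandermonde unitfE.
apply/prodf_neq0 => i _; apply/prodf_neq0 => j lt_ij.
rewrite !mxE subr_eq0 nth_uniq ?main_eigenvalues_uniq //.
by rewrite gtn_eqF.
Qed.

Lemma tr_mainmx_mul :
  mainmx^T *m mainmx = diag_mx (\row_k dotv (projj (mainv k)) (projj (mainv k))).
Proof.
apply/matrixP => k l; rewrite !mxE.
transitivity (dotv (projj (mainv k)) (projj (mainv l))).
  by apply: eq_bigr => i _; rewrite !mxE.
have [-> //|neq_kl] := eqVneq k l.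
rewrite mulr0n; apply: (@dotv_eigspace_neq _ _ A (mainv k) (mainv l)) => //;
  do ?exact: orthoproj_jvec_eigspace.
by rewrite nth_uniq ?main_eigenvalues_uniq.
Qed.

(** The Gram matrix of the projections is diagonal with positive squared norms, hence invertible,
    and its rank bounds that of [mainmx^T] from below. *)
Lemma tr_mainmx_row_free : row_free mainmx^T.
Proof.
suff BBunit : mainmx^T *m mainmx \in unitmx.
  by rewrite -row_leq_rank -[X in (X <= _)%N](mxrank_unit BBunit) mxrankM_maxl.
rewrite tr_mainmx_mul unitmxE det_diag unitfE; apply/prodf_neq0 => k _.
rewrite mxE gt_eqF // dotv_gt0 // orthoproj_jvec_neq0 //.
by apply/mem_main_eigenvalues; rewrite mem_nth.
Qed.

(** [:=:] compares row spaces, so column spaces are handled through transposes. *)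
Lemma tr_walkmx_eqmx : ((walkmx A)^T :=: mainmx^T)%MS.
Proof.
rewrite walkmx_mainmx trmx_mul; apply: eqmxMfull.
by rewrite row_full_unit unitmx_tr Vandermonde_main_unit.
Qed.

Lemma tr_walkmx_row_free : row_free (walkmx A)^T.
Proof. by rewrite /row_free tr_walkmx_eqmx; exact: tr_mainmx_row_free. Qed.

Lemma mem_Main x : (x \in Main A) = (x^T <= (walkmx A)^T)%MS.
Proof.
rewrite tr_walkmx_eqmx; apply/idP/submxP => [xM|[c /(congr1 trmx)]].
  pose s := map_tuple projj (in_tuple (main_eigenvalues A)).
  rewrite (coord_span (xM : x \in <<s>>%VS)).
  exists (\row_k coord s k x); apply: trmx_inj.
  rewrite trmxK trmx_mul trmxK; apply/colP => i; rewrite summxE mxE.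
  by apply: eq_bigr => k _; rewrite !mxE /= (nth_map 0) // mulrC.
rewrite trmxK trmx_mul trmxK => ->.
have -> : mainmx *m c^T = \sum_k c 0 k *: projj (mainv k).
  apply/colP => i; rewrite summxE mxE.
  by apply: eq_bigr => k _; rewrite !mxE mulrC.
by apply: memv_suml => k _; apply/memvZ/memv_span/map_f; rewrite mem_nth.
Qed.

End MainSpace.

Lemma adjmx_sym (R : realType) (n : nat) (G : sgraph n) :
  (adjmx R G)^T = adjmx R G.
Proof. by apply/matrixP => i j; rewrite !mxE adj_sym. Qed.

(** * Equal column spaces and invertible right factors *)

Lemma eq_MainP (R : realType) (n : nat) (A B : 'M[R]_n) :
  A^T = A -> B^T = B ->
  Main A = Main B <-> ((walkmx A)^T :=: (walkmx B)^T)%MS.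
Proof.
move=> symA symB; split=> [eqM|eqW]; last first.
  apply/vspaceP => x; apply: etrans (mem_Main symA x) _.
  by rewrite eqW; exact: esym (mem_Main symB x).
have sub_iff (x : 'cV_n) : (x^T <= (walkmx A)^T)%MS = (x^T <= (walkmx B)^T)%MS.
  by apply: etrans (esym (mem_Main symA x)) _; rewrite eqM; apply: mem_Main.
apply/eqmxP/andP; split; apply/row_subP => i; rewrite -[row i _]trmxK.
  by rewrite -sub_iff trmxK row_sub.
by rewrite sub_iff trmxK row_sub.
Qed.

Lemma eqmx_row_freeP (F : fieldType) (m n : nat) (A B : 'M[F]_(m, n)) :
  row_free A -> row_free B ->
  (A :=: B)%MS <-> exists2 Q : 'M_m, Q \in unitmx & Q *m A = B.
Proof.
move=> freeA freeB; split=> [eqAB|[Q Qunit <-]]; last first.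
  by apply/eqmx_sym/eqmxMfull; rewrite row_full_unit.
have /submxP[Q BE] : (B <= A)%MS by rewrite eqAB.
(* [B = Q A] has rank [m], so the square matrix [Q] has rank at least [m]. *)
exists Q => //; rewrite -row_free_unit -row_leq_rank.
by rewrite -[X in (X <= _)%N](eqP freeB) BE mxrankM_maxl.
Qed.

(** The column counts [p] and [q] are a priori different, so [e] is part of the claim and the cast
    only retypes [W]. *)
Lemma eqmx_tr_castmxP (F : fieldType) (n p q : nat)
    (V : 'M[F]_(n, p)) (W : 'M[F]_(n, q)) :
  row_free V^T -> row_free W^T ->
  (V^T :=: W^T)%MS <->
  exists (e : q = p) (Q : 'M[F]_p),
    Q \in unitmx /\ V *m Q = castmx (erefl n, e) W.
Proof.
move=> freeV freeW; split=> [eqVW|[e]].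
  (* Both counts are the rank of the common row space. *)
  have e : q = p by rewrite -(eqP freeV) -(eqP freeW) eqVW.
  exists e; case: _ / e V freeV eqVW => V freeV.
  move/(eqmx_row_freeP freeV freeW) => [Q Qunit QV].
  exists Q^T; rewrite unitmx_tr castmx_id; split=> //.
  by apply: trmx_inj; rewrite trmx_mul trmxK.
case: _ / e V freeV => V freeV [Q [Qunit]]; rewrite castmx_id => QV.
apply/(eqmx_row_freeP freeV freeW); exists Q^T; rewrite ?unitmx_tr //.
by rewrite -trmx_mul QV.
Qed.

Theorem theorem5p6 (R : realType) (n : nat) (G H : sgraph n) :
  Main (adjmx R G) = Main (adjmx R H) <->
  exists (e : num_main (adjmx R H) = num_main (adjmx R G))
         (Q : 'M[R]_(num_main (adjmx R G))),
    Q \in unitmx /\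
    walkmx (adjmx R G) *m Q = castmx (erefl n, e) (walkmx (adjmx R H)).
Proof.
have [symG symH] := (adjmx_sym R G, adjmx_sym R H).
apply: iff_trans (eq_MainP symG symH) _.
exact: eqmx_tr_castmxP (tr_walkmx_row_free symG) (tr_walkmx_row_free symH).
Qed.
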